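(* Let $E$ be an $n$-dimensional vector space over a field $\mathbb{F}$. Let $(E,\mathcal{I})$ be a collection of independent spaces and let $(E,\mathcal{B})$ be a collection of bases. 1. $(E,\mathcal{I})$ determines a $q$-matroid with collection of independent spaces $\mathcal{I}$ and collection of bases $\mathcal{B}_{\mathcal{I}}$; that is, there is exactly one $q$-matroid $(E,r)$ whose collection of independent spaces is $\mathcal{I}$ and whose collection of bases is $\mathcal{B}_{\mathcal{I}}$. 2. $(E,\mathcal{B})$ determines a $q$-matroid with collection of bases $\mathcal{B}$ and collection of independent spaces $\mathcal{I}_{\mathcal{B}}$; that is, there is exactly one $q$-matroid $(E,r)$ whose collection of bases is $\mathcal{B}$ and whose collection of independent spaces is $\mathcal{I}_{\mathcal{B}}$.
   Context: $n$ is a positive integer, $\mathbb{F}$ is an arbitrary field, and $\mathcal{L}(E)$ denotes the lattice of all subspaces of $E$; for a subspace $A$, $\mathcal{L}(A)$ is the set of all subspaces of $A$. For a family $\mathcal{A}\subseteq\mathcal{L}(E)$, $\max(\mathcal{A})$ is the set of members of $\mathcal{A}$ that are maximal with respect to inclusion. For $X\in\mathcal{L}(E)$, $\max(X,\mathcal{A})$ is the set of members of $\mathcal{A}$ contained in $X$ that have the largest dimension among all members of $\mathcal{A}$ contained in $X$, and $X\cap\mathcal{A}:=\{X\cap A:A\in\mathcal{A}\}$. A $q$-matroid with ground space $E$ is a pair $(E,r)$ where $r$ is an integer-valued function on $\mathcal{L}(E)$ such that: (R1) $0\leq r(A)\leq\dim A$ for all $A$; (R2) $r(A)\leq r(B)$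 for all $A\subseteq B$; (R3) $r(A+B)+r(A\cap B)\leq r(A)+r(B)$ for all $A,B$. A subspace $A$ is independent in $(E,r)$ if $r(A)=\dim A$; a basis is an independent space that is maximal with respect to inclusion among independent spaces. $(E,\mathcal{I})$ with $\mathcal{I}\subseteq\mathcal{L}(E)$ is a collection of independent spaces if: (I1) $\mathcal{I}\neq\emptyset$. (I2) For all $I,J\in\mathcal{L}(E)$, if $J\in\mathcal{I}$ and $I\subseteq J$, then $I\in\mathcal{I}$. (I3) For all $I,J\in\mathcal{I}$ with $\dim I<\dim J$, there exists a $1$-dimensional subspace $x\subseteq J$, $x\not\subseteq I$, such that $I+x\in\mathcal{I}$. (I4) For all $A,B\in\mathcal{L}(E)$ and $I,J\in\mathcal{L}(E)$ such that $I\in\max(\mathcal{I}\cap\mathcal{L}(A))$ and $J\in\max(\mathcal{I}\cap\mathcal{L}(B))$, there exists $K\in\max(\mathcal{I}\cap\mathcal{L}(A+B))$ such that $K\subseteq I+J$. $(E,\mathcal{B})$ with $\mathcal{B}\subseteq\mathcal{L}(E)$ is a collection of bases if: (B1) $\mathcal{B}\neq\emptyset$. (B2) For all $B_1,B_2\in\mathcal{B}$, if $B_1\subseteq B_2$, then $B_1=B_2$. (B3) For all $B_1,B_2\in\mathcal{B}$ and for every subspace $A$ of codimension $1$ in $B_1$ satisfying $B_1\cap B_2\subseteq A$, there is a $1$-dimensional subspace $y$ of $B_2$ such that $A+y\in\mathcal{B}$. (B4) For all $A,B\in\mathcal{L}(E)$ and $I,J\in\mathcal{L}(E)$ such that $I\in\max(E,A\cap\mathcal{B})$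 and $J\in\max(E,B\cap\mathcal{B})$, there exists $K\in\max(E,(A+B)\cap\mathcal{B})$ such that $K\subseteq I+J$. Define $\mathcal{B}_{\mathcal{I}}=\max(\mathcal{I})$ and $\mathcal{I}_{\mathcal{B}}=\{I\in\mathcal{L}(E): I\subseteq B\text{ for some }B\in\mathcal{B}\}$. *)

(* Defs.v *)
From mathcomp Require Import all_boot all_order all_algebra.
From mathcomp Require Import boolp classical_sets.

Set Implicit Arguments.
Unset Strict Implicit.
Unset Printing Implicit Defensive.

Local Open Scope classical_set_scope.
Local Open Scope ring_scope.

Section QMatroid.
Variables (F : fieldType) (E : vectType F).
Implicit Types (A B I J K X Y : {vspace E}) (S : set {vspace E}).

Definition subspaces A : set {vspace E} := [set X | (X <= A)%VS].

Definition max_incl S : set {vspace E} :=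
  [set X | S X /\ forall Y, S Y -> (X <= Y)%VS -> Y = X].

(* Selects by largest dimension among members below X; max_incl above selects
   by inclusion. *)
Definition max_dim X S : set {vspace E} :=
  [set Y | [/\ S Y, (Y <= X)%VS &
    forall Z, S Z -> (Z <= X)%VS -> (\dim Z <= \dim Y)%N]].

Definition cap_family X S : set {vspace E} := [set (X :&: A)%VS | A in S].

(* A q-matroid (E, r) is represented by its rank function r alone. *)
Definition is_qmatroid (r : {vspace E} -> int) : Prop :=
  [/\ forall A, 0 <= r A <= (\dim A)%:Z,
      forall A B, (A <= B)%VS -> r A <= r B &
      forall A B, r (A + B)%VS + r (A :&: B)%VS <= r A + r B].

Definition independent_spaces (r : {vspace E} -> int) : set {vspace E} :=
  [set A | r A = (\dim A)%:Z].

Definition bases (r : {vspace E} -> int) : set {vspace E} :=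
  max_incl (independent_spaces r).

Record is_independent_collection (II : set {vspace E}) : Prop := {
  indep_I1 : II !=set0;
  indep_I2 : forall I J, II J -> (I <= J)%VS -> II I;
  indep_I3 : forall I J, II I -> II J -> (\dim I < \dim J)%N ->
    exists x : {vspace E},
      [/\ \dim x = 1%N, (x <= J)%VS, ~~ (x <= I)%VS & II (I + x)%VS];
  indep_I4 : forall A B I J,
    max_incl (II `&` subspaces A) I -> max_incl (II `&` subspaces B) J ->
    exists K, max_incl (II `&` subspaces (A + B)%VS) K /\ (K <= I + J)%VS
}.

Record is_basis_collection (BB : set {vspace E}) : Prop := {
  basis_B1 : BB !=set0;
  basis_B2 : forall B1 B2, BB B1 -> BB B2 -> (B1 <= B2)%VS -> B1 = B2;
  basis_B3 : forall B1 B2 A, BB B1 -> BB B2 ->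
    (A <= B1)%VS -> \dim B1 = (\dim A).+1 -> (B1 :&: B2 <= A)%VS ->
    exists y : {vspace E}, [/\ \dim y = 1%N, (y <= B2)%VS & BB (A + y)%VS];
  basis_B4 : forall A B I J,
    max_dim fullv (cap_family A BB) I -> max_dim fullv (cap_family B BB) J ->
    exists K, max_dim fullv (cap_family (A + B)%VS BB) K /\ (K <= I + J)%VS
}.

Definition bases_of_indep (II : set {vspace E}) : set {vspace E} :=
  max_incl II.

Definition indep_of_bases (BB : set {vspace E}) : set {vspace E} :=
  [set I | exists2 B, BB B & (I <= B)%VS].

End QMatroid.

(* Main.v *)
Require Import Defs.
From mathcomp Require Import all_boot all_order all_algebra.
From mathcomp Require Import boolp classical_sets.
From mathcomp Require Import zify.

(** Three facts carry the theorem.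

    A q-matroid is determined by its independent spaces
    ([independent_spaces_inj]).  Submodularity propagates rank stagnation: if no
    line of [A] raises the rank of [I], then no larger subspace of [A] does.
    Hence an independent subspace of [A] of largest dimension already has the
    rank of [A] ([qmatroid_rank_attained]).

    An independence collection [II] is realised by the function sending [A] to
    the largest dimension of a member of [II] inside [A]
    ([exists_rank_of_indep]).  For submodularity, extend a largest member inside
    [A :&: B] to maximal members [IA] inside [A] and [IB] inside [B]; by (I3)
    these have the largest dimension there.  Axiom (I4) puts a largest member
    inside [A + B] into [IA + IB], and the dimension formula for [IA + IB] is
    the required inequality.

    The subspaces of members of a basis collection form an independence
    collection ([indep_of_bases_collection]) whose maximal members are the given
    bases ([max_incl_indep_of_bases]), so that the second part follows from the
    first.  The work is in (I3): given [I] and [J], take bases [B1] and [B2]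
    above them that meet in the largest possible dimension
    ([exists_close_bases]).  Every exchange of a hyperplane containing
    [B1 :&: B2] enlarges this intersection, so no such hyperplane of [B1]
    contains [I], and none of [B2] contains [J].  Therefore
    [B1 = I + (B1 :&: B2)] and [B2 = J + (B1 :&: B2)].  A line of [J :&: B1]
    outside [I] augments [I] within [B1]; if there is none, then
    [J :&: B1 <= I :&: B2], and since bases have equal dimension, counting gives
    [\dim J <= \dim I]. *)

Set Implicit Arguments.
Unset Strict Implicit.
Unset Printing Implicit Defensive.

Import Order.TTheory GRing.Theory Num.Theory.

Local Open Scope classical_set_scope.
Local Open Scope ring_scope.

(** * Subspaces, hyperplanes and lines *)

Section Subspaces.
Variables (F : fieldType) (E : vectType F).
Implicit Types (A B C X Y : {vspace E}) (S : set {vspace E}).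

Lemma exists_max_dim S : S !=set0 ->
  exists X, S X /\ forall Y, S Y -> (\dim Y <= \dim X)%N.
Proof.
move=> [X0 SX0]; pose P m := `[< exists X, S X /\ \dim X = m >].
have exP : exists m, P m by exists (\dim X0); apply/asboolP; exists X0.
have ubP m : P m -> (m <= \dim (fullv : {vspace E}))%N.
  by move=> /asboolP[X [_ <-]]; exact: dimvS (subvf X).
case: (ex_maxnP exP ubP) => m /asboolP[X [SX dX]] maxm.
exists X; split=> // Y SY; rewrite dX; apply: maxm.
by apply/asboolP; exists Y.
Qed.

(** Remove one vector from a complement of [A] in [B]. *)
Lemma exists_hyperplane_above A B : (A <= B)%VS -> (\dim A < \dim B)%N ->
  exists C, [/\ (A <= C)%VS, (C <= B)%VS & \dim B = (\dim C).+1].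
Proof.
move=> sAB ltAB; pose D := (B :\: A)%VS; pose v := vpick D.
have dD : (\dim (B :&: A) + \dim D = \dim B)%N by rewrite dimv_cap_compl.
rewrite (capv_idPr sAB) in dD.
have v0 : v != 0 by rewrite vpick0 -dimv_eq0; lia.
have vD : (<[v]> <= D)%VS by rewrite -memvE memv_pick.
have dDv : (\dim (D :&: <[v]>) + \dim (D :\: <[v]>) = \dim D)%N.
  by rewrite dimv_cap_compl.
rewrite (capv_idPr vD) dim_vline v0 in dDv.
pose C := (A + (D :\: <[v]>))%VS.
have sCB : (C <= B)%VS.
  by rewrite subv_add sAB (subv_trans (diffvSl _ _)) // diffvSl.
have dC := dimv_add_leqif A (D :\: <[v]>)%VS.
have sBC : (B <= C + <[v]>)%VS.
  have sD : (D <= D :\: <[v]> + <[v]>)%VS.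
    by rewrite -{1}(addv_diff_cap D <[v]>) addvS ?capvSr.
  rewrite -{1}(addv_diff_cap B A) subv_add -addvA; apply/andP; split.
    exact: subv_trans sD (addvSr _ _).
  exact: subv_trans (capvSr _ _) (addvSl _ _).
have dBC := dimvS sBC.
have dCv := dimv_add_leqif C <[v]>%VS.
exists C; split=> //; first exact: addvSl.
have := leq_of_leqif dC; have := leq_of_leqif dCv.
rewrite dim_vline v0 -/C; lia.
Qed.

Lemma line_notin X A : \dim X = 1%N -> ~~ (X <= A)%VS ->
  \dim (A + X)%VS = (\dim A).+1.
Proof.
move=> dX nXA; have dAX := dimv_sum_cap A X.
have : (\dim (A :&: X) < \dim X)%N.
  rewrite ltn_neqAle dimvS ?capvSr // andbT.
  apply: contra nXA => /eqP dAXX; apply/capv_idPr/eqP.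
  by rewrite eqEdim capvSr dAXX /=.
lia.
Qed.

Lemma exists_line_notin A B : ~~ (A <= B)%VS ->
  exists X, [/\ \dim X = 1%N, (X <= A)%VS & ~~ (X <= B)%VS].
Proof.
move=> /subvPn[v vA vB]; exists <[v]>%VS; rewrite -!memvE; split=> //.
by rewrite dim_vline; case: eqP vB => // ->; rewrite mem0v.
Qed.

End Subspaces.

(** * A q-matroid is determined by its independent spaces *)

Section RankFromIndependents.
Variables (F : fieldType) (E : vectType F).
Implicit Types (A B I J X : {vspace E}) (r : {vspace E} -> int).

(** Take [I] independent in [A] of largest dimension, and [J] as large as
    possible between [I] and [A] with the rank of [I]: submodularity leaves no
    line of [A] outside [J]. *)
Lemma qmatroid_rank_attained r A : is_qmatroid r ->
  exists I, [/\ (I <= A)%VS, independent_spaces r I & r I = r A].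
Proof.
move=> [R1 R2 R3].
have [|I [[sIA indI] maxI]] := @exists_max_dim F E
  [set I | (I <= A)%VS /\ independent_spaces r I].
  exists 0%VS; split; first exact: sub0v.
  by rewrite /independent_spaces /=; have := R1 0%VS; rewrite dimv0; lia.
rewrite /independent_spaces /= in indI maxI.
exists I; split=> //.
have [|J [[sIJ sJA rJ] maxJ]] := @exists_max_dim F E
  [set J | [/\ (I <= J)%VS, (J <= A)%VS & r J = r I]].
  by exists I; split.
case: (boolP (A <= J)%VS) => [sAJ|/exists_line_notin[X [dX sXA nXJ]]].
  by rewrite -rJ; congr r; apply/eqP; rewrite eqEsubv sJA.
(* The line X cannot raise the rank of I, and by submodularity it cannot raise
   that of J either. *)
have nXI : ~~ (X <= I)%VS by apply: contra nXJ => /subv_trans; apply.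
have sIXA : (I + X <= A)%VS by rewrite subv_add sIA.
have rIX : r (I + X)%VS = r I.
  have := R2 _ _ (addvSl I X); have := R1 (I + X)%VS.
  rewrite (line_notin dX nXI) => h1 h2.
  case: (eqVneq (r (I + X)%VS) (\dim I).+1%:Z) => [e|]; last lia.
  have := maxI (I + X)%VS; rewrite (line_notin dX nXI).
  by move=> /(_ (conj sIXA e)); lia.
have h1 := R3 J (I + X)%VS.
have h2 : r I <= r (J :&: (I + X))%VS.
  by apply: R2; rewrite subv_cap sIJ addvSl.
have h3 : r (J + X)%VS <= r (J + (I + X))%VS.
  by apply: R2; apply: addvS => //; exact: addvSr.
have h4 := R2 _ _ (addvSl J X).
have := maxJ (J + X)%VS; rewrite (line_notin dX nXJ) => maxJX.
suff : (\dim J < \dim J)%N by lia.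
apply: maxJX; split; last lia.
  exact: subv_trans sIJ (addvSl _ _).
by rewrite subv_add sJA.
Qed.

Lemma independent_spaces_inj r r' : is_qmatroid r -> is_qmatroid r' ->
  independent_spaces r = independent_spaces r' -> r = r'.
Proof.
have half r1 r2 A : is_qmatroid r1 -> is_qmatroid r2 ->
    independent_spaces r1 = independent_spaces r2 -> r1 A <= r2 A.
  move=> q1 [_ mono2 _] e12.
  have [I [sIA indI <-]] := qmatroid_rank_attained A q1.
  have := mono2 _ _ sIA; move: (indI); rewrite e12 => -> .
  by rewrite indI.
move=> q q' e; apply/funext => A; apply/eqP.
by rewrite eq_le (half _ _ _ q q' e) (half _ _ _ q' q (esym e)).
Qed.

End RankFromIndependents.

(** * The rank function of an independence collection *)

Section Augmentation.
Variables (F : fieldType) (E : vectType F) (II : set {vspace E}).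
Implicit Types (A I J : {vspace E}).
Hypothesis augmentII : forall I J, II I -> II J -> (\dim I < \dim J)%N ->
  exists x : {vspace E},
    [/\ \dim x = 1%N, (x <= J)%VS, ~~ (x <= I)%VS & II (I + x)%VS].

(** Augmentation makes the inclusion-maximal members inside [A] the largest
    ones.  This reduces (I4) and (B4), which speak of different kinds of
    maximality, to the same condition on dimensions. *)
Lemma max_incl_dim A I J : max_incl (II `&` subspaces A) I ->
  II J -> (J <= A)%VS -> (\dim J <= \dim I)%N.
Proof.
move=> [[II_I sIA] maxI] II_J sJA; rewrite leqNgt; apply/negP => ltIJ.
have [x [dx sxJ nxI IIx]] := augmentII II_I II_J ltIJ.
have sIxA : (I + x <= A)%VS by rewrite subv_add sIA (subv_trans sxJ).
have := line_notin dx nxI.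
by rewrite (maxI _ (conj IIx sIxA) (addvSl I x)); lia.
Qed.

End Augmentation.

Section QMatroidOfIndep.
Variables (F : fieldType) (E : vectType F) (II : set {vspace E}).
Implicit Types (A B I J K X : {vspace E}).
Hypothesis indepII : is_independent_collection II.

Let indep_max_dim := max_incl_dim (indep_I3 indepII).

Lemma indep0 : II 0%VS.
Proof.
by case: (indep_I1 indepII) => I /(indep_I2 indepII); apply; exact: sub0v.
Qed.

Lemma exists_max_incl_above A I : II I -> (I <= A)%VS ->
  exists J, (I <= J)%VS /\ max_incl (II `&` subspaces A) J.
Proof.
move=> II_I sIA.
have [|J [[II_J sIJ sJA] maxJ]] := @exists_max_dim F E
  [set J | [/\ II J, (I <= J)%VS & (J <= A)%VS]]; first by exists I; split.
exists J; split=> //; split=> // K [II_K sKA] sJK; apply/eqP.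
rewrite eq_sym eqEdim sJK; apply: maxJ; split=> //.
exact: subv_trans sIJ sJK.
Qed.

Lemma exists_rank_of_indep :
  exists r, is_qmatroid r /\ independent_spaces r = II.
Proof.
have /choice[f maxf] A : exists I, max_incl (II `&` subspaces A) I.
  have [I [_ maxI]] := exists_max_incl_above indep0 (sub0v A).
  by exists I.
have rkE A I : max_incl (II `&` subspaces A) I -> \dim (f A) = \dim I.
  move=> maxI; apply/eqP; rewrite eqn_leq.
  have [[? ?] _] := maxI; have [[? ?] _] := maxf A.
  by rewrite (indep_max_dim maxI) // (indep_max_dim (maxf A)).
exists (fun A => (\dim (f A))%:Z); split; first split=> [A|A B sAB|A B].
- by have [[_ sfA] _] := maxf A; have := dimvS sfA; lia.
- have [[IIf sfA] _] := maxf A.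
  have sfB := subv_trans sfA sAB.
  by have := indep_max_dim (maxf B) IIf sfB; lia.
- have [[IIf sf] _] := maxf (A :&: B)%VS.
  have [IA [sIA maxA]] :=
    exists_max_incl_above IIf (subv_trans sf (capvSl A B)).
  have [IB [sIB maxB]] :=
    exists_max_incl_above IIf (subv_trans sf (capvSr A B)).
  have [K [maxK sK]] := indep_I4 indepII maxA maxB.
  rewrite (rkE _ _ maxA) (rkE _ _ maxB) (rkE _ _ maxK).
  have := dimvS sK; have := dimv_sum_cap IA IB.
  have : (f (A :&: B) <= IA :&: IB)%VS by rewrite subv_cap sIA.
  by move/dimvS; lia.
- apply/seteqP; split=> A; rewrite /independent_spaces /=.
    case=> dA; have [[IIf sfA] _] := maxf A.
    suff <- : f A = A by [].
    by apply/eqP; rewrite eqEdim sfA dA /=.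
  move=> II_A; have [[_ sfA] _] := maxf A.
  have := indep_max_dim (maxf A) II_A (subvv A).
  by have := dimvS sfA; lia.
Qed.

End QMatroidOfIndep.

(** * From bases to independent spaces *)

Section IndepOfBases.
Variables (F : fieldType) (E : vectType F) (BB : set {vspace E}).
Implicit Types (A B I J K X : {vspace E}).
Hypothesis basisBB : is_basis_collection BB.

Lemma max_incl_indep_of_bases : max_incl (indep_of_bases BB) = BB.
Proof.
apply/seteqP; split=> [X [[B BB_B sXB] maxX]|X BB_X].
  suff <- : B = X by [].
  by apply: maxX => //; exists B.
split=> [|Y [B BB_B sYB] sXY]; first by exists X.
have XB := basis_B2 basisBB BB_X BB_B (subv_trans sXY sYB).
by apply/eqP; rewrite eqEsubv sXY andbT XB.
Qed.

(** Axiom (B2) forces the line [y] of (B3) out of the hyperplane: this is what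
    makes an exchange preserve the dimension and strictly enlarge the
    intersection, the measure of progress in [exists_close_bases]. *)
Lemma basis_exchange I B1 B2 : BB B1 -> BB B2 -> (I <= B1)%VS ->
    (I + (B1 :&: B2))%VS != B1 ->
  exists B, [/\ BB B, (I <= B)%VS, \dim B = \dim B1
    & (\dim (B1 :&: B2) < \dim (B :&: B2))%N].
Proof.
move=> BB1 BB2 sIB1 neB1.
have sIcap : (I + (B1 :&: B2) <= B1)%VS by rewrite subv_add sIB1 capvSl.
have ltIcap : (\dim (I + (B1 :&: B2)) < \dim B1)%N.
  by rewrite ltnNge; apply: contra neB1; rewrite eqEdim sIcap.
have [A [sIcapA sAB1 dB1]] := exists_hyperplane_above sIcap ltIcap.
have scapA := subv_trans (addvSr _ _) sIcapA.
have [y [dy syB2 BBAy]] := basis_B3 basisBB BB1 BB2 sAB1 dB1 scapA.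
have nyA : ~~ (y <= A)%VS.
  apply/negP => /addv_idPl AyA; rewrite AyA in BBAy.
  by have := basis_B2 basisBB BBAy BB1 sAB1 => e; rewrite e in dB1; lia.
exists (A + y)%VS; split=> //.
- exact: subv_trans (subv_trans (addvSl _ _) sIcapA) (addvSl _ _).
- by rewrite (line_notin dy nyA).
have nycap : ~~ (y <= B1 :&: B2)%VS.
  by apply: contra nyA => /subv_trans; apply.
rewrite -(line_notin dy nycap); apply: dimvS.
by rewrite subv_cap addvS //= subv_add capvSr.
Qed.

(** Take the pair of bases above [I] and [J] whose intersection is largest: an
    exchange of a hyperplane of [C1] containing [I] would enlarge it, so [I]
    and [C1 :&: C2] already span [C1], and likewise for [J] and [C2].  Exchanges preserve
    dimensions; recording this yields [basis_dim_eq], by taking [I] and [J] to be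
    zero. *)
Lemma exists_close_bases I J B1 B2 : BB B1 -> BB B2 ->
    (I <= B1)%VS -> (J <= B2)%VS ->
  exists C1 C2, [/\ BB C1, BB C2, \dim C1 = \dim B1 & \dim C2 = \dim B2] /\
    [/\ (I <= C1)%VS, (J <= C2)%VS, (I + (C1 :&: C2))%VS = C1
      & (J + (C1 :&: C2))%VS = C2].
Proof.
move=> BB1 BB2 sIB1 sJB2.
pose above C1 C2 := [/\ BB C1, BB C2, \dim C1 = \dim B1 & \dim C2 = \dim B2] /\
  (I <= C1)%VS /\ (J <= C2)%VS.
have [|X [[C1 [C2 [[[BC1 BC2 dC1 dC2] [sIC1 sJC2]] ->]]] maxC]] :=
    @exists_max_dim F E
      [set X | exists C1 C2, above C1 C2 /\ X = (C1 :&: C2)%VS].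
  by exists (B1 :&: B2)%VS, B1, B2.
exists C1, C2; split=> //; split=> //; apply/eqP/negP => /negP ne.
  have [B [BB_B sIB dB ltB]] := basis_exchange BC1 BC2 sIC1 ne.
  suff : (\dim (B :&: C2) <= \dim (C1 :&: C2))%N by lia.
  by apply: maxC; exists B, C2; split=> //; split=> //; split=> //; rewrite dB.
rewrite capvC in ne.
have [B [BB_B sJB dB ltB]] := basis_exchange BC2 BC1 sJC2 ne.
suff : (\dim (C1 :&: B) <= \dim (C1 :&: C2))%N.
  by rewrite capvC (capvC C1 C2); lia.
by apply: maxC; exists C1, B; split=> //; split=> //; split=> //; rewrite dB.
Qed.

Lemma basis_dim_eq B1 B2 : BB B1 -> BB B2 -> \dim B1 = \dim B2.
Proof.
move=> BB1 BB2.
have [C1 [C2 [[_ _ <- <-] [_ _]]]] :=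
  exists_close_bases BB1 BB2 (sub0v B1) (sub0v B2).
by rewrite !add0v => e1 e2; rewrite -[in LHS]e1 -[in RHS]e2.
Qed.

Lemma indep_of_bases_augment I J :
    indep_of_bases BB I -> indep_of_bases BB J -> (\dim I < \dim J)%N ->
  exists x : {vspace E}, [/\ \dim x = 1%N, (x <= J)%VS, ~~ (x <= I)%VS
    & indep_of_bases BB (I + x)%VS].
Proof.
move=> [B1 BB1 sIB1] [B2 BB2 sJB2] ltIJ.
have [C1 [C2 [[BC1 BC2 _ _] [sIC1 sJC2 defC1 defC2]]]] :=
  exists_close_bases BB1 BB2 sIB1 sJB2.
case: (boolP (J :&: C1 <= I)%VS) => [sJC1I|/exists_line_notin[x [dx]]].
  (* The trace of J on C1 lies in that of I on C2, whereas I and J span the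
     spaces C1 and C2, of the same dimension, modulo C1 :&: C2.  Counting
     then contradicts ltIJ. *)
  have eI := dimv_sum_cap I (C1 :&: C2)%VS.
  have eJ := dimv_sum_cap J (C1 :&: C2)%VS.
  rewrite defC1 capvA (capv_idPl sIC1) in eI.
  rewrite defC2 (capvC C1) capvA (capv_idPl sJC2) in eJ.
  have sJI : (J :&: C1 <= I :&: C2)%VS.
    by rewrite subv_cap sJC1I (subv_trans (capvSl _ _)).
  have := dimvS sJI; have := basis_dim_eq BC1 BC2.
  rewrite (capvC C2) in eJ; lia.
rewrite subv_cap => /andP[sxJ sxC1] nxI; exists x; split=> //.
by exists C1; rewrite // subv_add sIC1.
Qed.

(** The intersections of [A] with bases are cofinal among the independent
    subspaces of [A], so both sides select independent subspaces of [A]; by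
    augmentation the largest ones and the maximal ones agree. *)
Lemma max_dim_cap_family A I :
  max_dim fullv (cap_family A BB) I <->
  max_incl (indep_of_bases BB `&` subspaces A) I.
Proof.
have capI B : BB B -> (indep_of_bases BB `&` subspaces A) (A :&: B)%VS.
  by move=> BB_B; split; [exists B; rewrite ?capvSr | exact: capvSl].
split=> [[[B BB_B <-] _ maxB]|maxI].
  split=> [|Y [[B' BB_B' sYB'] sYA] sBY]; first exact: capI.
  apply/eqP; rewrite eq_sym eqEdim sBY.
  have sYAB' : (Y <= A :&: B')%VS by rewrite subv_cap sYA.
  apply: leq_trans (dimvS sYAB') (maxB _ _ (subvf _)).
  by exists B'.
have [[[B BB_B sIB] sIA] maxIA] := maxI; split; last 2 first.
- exact: subvf.
- move=> _ [B' /capI[indB' sB'A] <-] _.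
  exact: (max_incl_dim indep_of_bases_augment maxI).
by exists B => //; apply: maxIA; [exact: capI | rewrite subv_cap sIA].
Qed.

Lemma indep_of_bases_collection : is_independent_collection (indep_of_bases BB).
Proof.
split=> [|I J [B BB_B sJB] sIJ||A B I J].
- by case: (basis_B1 basisBB) => B BB_B; exists B, B.
- by exists B => //; exact: subv_trans sIJ sJB.
- exact: indep_of_bases_augment.
move=> /max_dim_cap_family maxI /max_dim_cap_family maxJ.
have [K [maxK sK]] := basis_B4 basisBB maxI maxJ.
by exists K; split=> //; apply/max_dim_cap_family.
Qed.

End IndepOfBases.

(** * The determined q-matroids *)

Theorem corollary37 (F : fieldType) (n : nat) (E : vectType F)
    (II BB : set {vspace E}) :
  (0 < n)%N -> \dim (fullv : {vspace E}) = n ->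
  is_independent_collection II -> is_basis_collection BB ->
  (exists! r : {vspace E} -> int,
     [/\ is_qmatroid r, independent_spaces r = II
       & bases r = bases_of_indep II])
  /\
  (exists! r : {vspace E} -> int,
     [/\ is_qmatroid r, bases r = BB
       & independent_spaces r = indep_of_bases BB]).
Proof.
move=> _ _ indepII basisBB; split.
  have [r [qr rII]] := exists_rank_of_indep indepII.
  exists r; split=> [|r' [qr' r'II _]]; first by split; rewrite // /bases rII.
  by apply: independent_spaces_inj; rewrite // rII.
have [r [qr rBB]] := exists_rank_of_indep (indep_of_bases_collection basisBB).
exists r; split=> [|r' [qr' _ r'BB]].
  by split; rewrite // /bases rBB max_incl_indep_of_bases.
by apply: independent_spaces_inj; rewrite // rBB.
Qed.
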